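(* Let $E=(E^0,E^1,r,s)$ be a row-finite directed graph without sources, with graph groupoid $\Gamma(E^\infty,\sigma)$. Then the interior $\mathrm{Iso}(\Gamma(E^\infty,\sigma))^{\mathrm{o}}$ of the isotropy group bundle is closed in $\Gamma(E^\infty,\sigma)$.
   Context: A directed graph $E=(E^0,E^1,r,s)$ consists of countable (discrete) sets $E^0,E^1$ and maps $r,s:E^1\to E^0$. It is row-finite without sources if $r^{-1}(v)$ is finite and nonempty for every $v\in E^0$. $E^\infty=\{x\in\prod_{i=1}^\infty E^1: s(x_i)=r(x_{i+1})$ for all $i\ge1\}$ has the subspace topology of the product topology, and $\sigma(x_1x_2\cdots)=x_2x_3\cdots$ is the shift, a local homeomorphism. The graph groupoid is $\Gamma(E^\infty,\sigma)=\{(x,k-\ell,y)\in E^\infty\times\mathbb Z\times E^\infty: k,\ell\ge0,\ \sigma^k(x)=\sigma^\ell(y)\}$, with range $x$, source $y$, composition $(x,m,y)(y,m',z)=(x,m+m',z)$ and inverse $(x,m,y)^{-1}=(y,-m,x)$. Its topology has as base the sets $\mathcal U(U,V,k,\ell)=\{(x,k-\ell,y): x\in U,\ y\in V,\ \sigma^k(x)=\sigma^\ell(y)\}$ with $U,V\subset E^\infty$ open, $\sigma^k$ injective on $U$ and $\sigma^\ell$ injective on $V$. Equivalently, a base is given by the sets $Z(\alpha,\beta)=\{(\alpha x,|\alpha|-|\beta|,\beta x): x\in E^\infty,\ r(x)=s(\alpha)\}$ for finite paths $\alpha,\beta$ with $s(\alpha)=s(\beta)$. It is a locally compact Hausdorff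 étale groupoid. The isotropy group bundle is $\mathrm{Iso}(\Gamma(E^\infty,\sigma))=\{(x,m,x)\in\Gamma(E^\infty,\sigma)\}$, and $\mathrm{Iso}(\Gamma(E^\infty,\sigma))^{\mathrm{o}}$ is its interior in $\Gamma(E^\infty,\sigma)$. *)

(* Defs.v *)
From HB Require Import structures.
From mathcomp Require Import all_boot all_order all_algebra.
From mathcomp Require Import zify.
From mathcomp Require Import all_classical all_reals all_analysis.

Set Implicit Arguments.
Unset Strict Implicit.
Unset Printing Implicit Defensive.

Import GRing.Theory.
Local Open Scope ring_scope.
Local Open Scope classical_set_scope.

Record digraph := Digraph {
  vertex : countType;
  edge : countType;
  rng : edge -> vertex;
  src : edge -> vertex
}.

Definition row_finite_without_sources (E : digraph) : Prop :=
  forall v : vertex E,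
    finite_set (@rng E @^-1` [set v]) /\ @rng E @^-1` [set v] !=set0.

(* Edges of a path are numbered from 0. *)
Definition infinite_paths (E : digraph) :
    set {ptws nat -> discrete_topology (edge E)} :=
  [set x | forall i : nat, @src E (x i) = @rng E (x i.+1)].

(* As a set_type, the path space carries the subspace topology. *)
Notation path_space E := (set_type (@infinite_paths E)).

Section GraphGroupoid.
Variable E : digraph.

Local Notation X := (path_space E).

Lemma shift_subproof (x : X) :
  ((fun i => val x i.+1) : {ptws nat -> discrete_topology (edge E)})
    \in @infinite_paths E.
Proof. by apply/mem_set => i; exact: (set_mem (valP x)). Qed.

Definition shift (x : X) : X := SigSub (shift_subproof x).

Definition graph_groupoid : Type :=
  set_type [set g : X * int * X | exists k l : nat,
    g.1.2 = k%:Z - l%:Z /\ iter k shift g.1.1 = iter l shift g.2].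

HB.instance Definition _ := Choice.on graph_groupoid.

Definition grange (g : graph_groupoid) : X := (val g).1.1.
Definition gdegree (g : graph_groupoid) : int := (val g).1.2.
Definition gsource (g : graph_groupoid) : X := (val g).2.

Definition basic_set (U V : set X) (k l : nat) : set graph_groupoid :=
  [set g | [/\ U (grange g), V (gsource g), gdegree g = k%:Z - l%:Z
             & iter k shift (grange g) = iter l shift (gsource g)]].

Definition groupoid_base : set (set graph_groupoid) :=
  [set B | exists (U V : set X) (k l : nat),
    [/\ open U /\ open V, set_inj U (iter k shift), set_inj V (iter l shift)
      & B = basic_set U V k l]].

Lemma iter_shiftE k (x : X) i : val (iter k shift x) i = val x (k + i)%N.
Proof. by elim: k i => [|k IH] i //=; rewrite IH addnS addSn. Qed.

Definition cylinder (k : nat) (x : X) : set X :=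
  [set y | forall i, (i < k)%N -> val y i = val x i].

Lemma cylinder_open k x : open (cylinder k x).
Proof.
elim: k => [|k IH].
  suff -> : cylinder 0 x = setT by exact: openT.
  by apply/seteqP; split.
have -> : cylinder k.+1 x =
    cylinder k x `&` [set y | val y k = val x k].
  apply/seteqP; split=> y /=.
    by move=> h; split=> [i ik|]; apply: h => //; exact: ltnW.
  by move=> [h e] i; rewrite ltnS leq_eqVlt => /orP[/eqP ->|/h].
apply: openI => //.
exists (@proj nat (fun=> discrete_topology (edge E)) k @^-1` [set val x k]).
  apply: open_comp; first by move=> ? _; exact: proj_continuous.
  exact: discrete_open.
by [].
Qed.

Lemma cylinder_inj k x : set_inj (cylinder k x) (iter k shift).
Proof.
move=> y z /set_mem hy /set_mem hz e; apply: val_inj; apply/funext => i.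
have [ik|ki] := ltnP i k; first by rewrite hy // hz.
by rewrite -(subnKC ki) -!iter_shiftE e.
Qed.

Lemma groupoid_base_cover : \bigcup_(B in groupoid_base) B = setT.
Proof.
apply/seteqP; split=> // g _.
have [k [l [dg eg]]] := set_mem (valP g).
exists (basic_set (cylinder k (grange g)) (cylinder l (gsource g)) k l).
  exists (cylinder k (grange g)), (cylinder l (gsource g)), k, l.
  by split=> //; [split; exact: cylinder_open|exact: cylinder_inj..].
by split.
Qed.

Lemma basic_set_join U V k l U' V' k' l' g :
  (k <= k')%N ->
  [/\ open U /\ open V, set_inj U (iter k shift) & set_inj V (iter l shift)] ->
  open U' /\ open V' ->
  basic_set U V k l g -> basic_set U' V' k' l' g ->
  exists C, [/\ groupoid_base C, C g
              & C `<=` basic_set U V k l `&` basic_set U' V' k' l'].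
Proof.
move=> lek [[oU oV] iU iV] [oU' oV'] [gU gV dg eg] [gU' gV' dg' _].
exists (basic_set (U `&` U') (V `&` V') k l); split.
- exists (U `&` U'), (V `&` V'), k, l; split=> //.
  + by split; exact: openI.
  + by apply: sub_in2 iU => y /set_mem[? _]; exact/mem_set.
  + by apply: sub_in2 iV => y /set_mem[? _]; exact/mem_set.
- by split.
- move=> h [[hU hU'] [hV hV'] dh eh]; split; split=> //.
    by rewrite dh -dg dg'.
  have -> : k' = (k' - k + k)%N by lia.
  have -> : l' = (k' - k + l)%N by lia.
  by rewrite !iterD eh.
Qed.

Lemma groupoid_base_join (A B : set graph_groupoid) g :
  groupoid_base A -> groupoid_base B -> A g -> B g ->
  exists C, [/\ groupoid_base C, C g & C `<=` A `&` B].
Proof.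
move=> [U [V [k [l [oUV iU iV ->]]]]] [U' [V' [k' [l' [oUV' iU' iV' ->]]]]] Ag Bg.
have [kk'|/ltnW kk'] := leqP k k'.
  by apply: basic_set_join.
by rewrite setIC; apply: basic_set_join.
Qed.

HB.instance Definition _ := @isBaseTopological.Build graph_groupoid
  (set graph_groupoid) groupoid_base id groupoid_base_cover groupoid_base_join.

Definition isotropy : set graph_groupoid := [set g | grange g = gsource g].

End GraphGroupoid.

Arguments isotropy : clear implicits.

(* Main.v *)
Require Import Defs.
From mathcomp Require Import all_boot all_order all_algebra.
From mathcomp Require Import zify.
From mathcomp Require Import all_classical all_reals all_analysis.

Local Open Scope classical_set_scope.

(** Write an element of the groupoid as [(x, k - l, y)], where the [k]-th shift
    of [x] is the [l]-th shift of [y], and let it be a limit of the interior of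
    the isotropy.  The isotropy is closed: distinct paths differ at some
    edge, so they are separated by cylinders ([closed_isotropy]).  Hence
    [y = x], and two cases remain.

    - In degree zero the isotropy consists of units, and the unit space is open,
      the groupoid being étale ([isotropy_interior_degree0]).

    - In nonzero degree, the [k]-th and [l]-th shifts of [x] agree with
      [k <> l], so [x] is eventually periodic.  A path [z] whose [k]-th and
      [l]-th shifts agree as well, and which shares its first [maxn k l] edges
      with [x], is equal to [x].  The elements [(z, k - l, z)] given by such [z]
      are exactly the isotropy elements of a basic neighborhood of
      [(x, k - l, x)], so isotropy elements of nonzero degree are isolated in
      the isotropy ([isotropy_degree_neq0_isolated]).  The interior of the
      isotropy meets this neighborhood, so it contains the element itself. *)

Lemma groupoid_base_open {E : digraph} (B : set (graph_groupoid E)) :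
  groupoid_base B -> open B.
Proof. by exists [set B]; rewrite ?bigcup_set1// => _ ->. Qed.

Lemma cylinder_basic_set_nbhs {E : digraph} {g : graph_groupoid E} {k l : nat} :
  gdegree g = (k%:Z - l%:Z)%R ->
  iter k (@Defs.shift E) (grange g) = iter l (@Defs.shift E) (gsource g) ->
  nbhs g (basic_set (cylinder k (grange g)) (cylinder l (gsource g)) k l).
Proof.
move=> dg eg; apply: open_nbhs_nbhs; split; last by split.
apply: groupoid_base_open.
exists (cylinder k (grange g)), (cylinder l (gsource g)), k, l.
by split=> //; [split; exact: cylinder_open|exact: cylinder_inj..].
Qed.

(** Raising [k] and [l] together leaves the element [(x, k - l, y)] unchanged
    but shrinks the basic neighborhood, until its cylinders record an edge at
    which [x] and [y] differ. *)
Lemma closed_isotropy (E : digraph) : closed (isotropy E).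
Proof.
move=> g clg; have [k [l [dg eg]]] := set_mem (valP g).
apply/val_inj/funext => i.
have dg' : gdegree g = ((i.+1 + k)%:Z - (i.+1 + l)%:Z)%R.
  by rewrite [LHS]dg; lia.
have [|h [hiso [hx hy _ _]]] := clg _ (cylinder_basic_set_nbhs dg' _).
  by rewrite !iterD [iter k _ _]eg.
by rewrite -hx -?hy ?hiso//; lia.
Qed.

(** For equal exponents a basic set on a single cylinder consists of units,
    because the shift power is injective on that cylinder. *)
Lemma isotropy_interior_degree0 {E : digraph} {g : graph_groupoid E} :
  isotropy E g -> gdegree g = 0%R -> (isotropy E)° g.
Proof.
move=> isog d0; have [k [l [dg eg]]] := set_mem (valP g).
have kl : l = k by move: (etrans (esym dg) d0); lia.
subst l; apply: filterS (cylinder_basic_set_nbhs dg eg) => h.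
move=> [hx hy _ eh]; rewrite -isog in hy.
exact: (@cylinder_inj E k (grange g) _ _ (mem_set hx) (mem_set hy) eh).
Qed.

(** From position [l] on, both paths have period [k - l], and the first [k]
    edges contain a full period. *)
Lemma eventually_periodic_eq {E : digraph} {x z : path_space E} {k l : nat} :
  (l < k)%N ->
  iter k (@Defs.shift E) x = iter l (@Defs.shift E) x ->
  iter k (@Defs.shift E) z = iter l (@Defs.shift E) z ->
  cylinder k x z -> z = x.
Proof.
move=> lk ex ez zx; apply/val_inj/funext => i.
elim/ltn_ind: i => i IH; have [|ki] := ltnP i k; first exact: zx.
by rewrite -(subnKC ki) -!iter_shiftE ex ez !iter_shiftE; apply: IH; lia.
Qed.

(** Both cylinders are centred at the range of [g], so whichever of [k] and [l]
    is larger records enough edges to pin down the base point. *)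
Lemma isotropy_degree_neq0_isolated {E : digraph} {g : graph_groupoid E} :
  isotropy E g -> gdegree g <> 0%R ->
  exists2 N, nbhs g N & N `&` isotropy E `<=` [set g].
Proof.
move=> isog d0; have [k [l [dg eg]]] := set_mem (valP g).
exists (basic_set (cylinder k (grange g)) (cylinder l (gsource g)) k l).
  exact: cylinder_basic_set_nbhs.
move=> h [[hx hy dh eh] isoh].
have ex : iter k (@Defs.shift E) (grange g) = iter l (@Defs.shift E) (grange g).
  by rewrite [RHS](congr1 _ isog).
rewrite -isoh in hy eh; rewrite -isog in hy.
have rgh : grange h = grange g.
  have [kl|lk|kl] := ltngtP k l.
  - exact: eventually_periodic_eq kl (esym ex) (esym eh) hy.
  - exact: eventually_periodic_eq lk ex eh hx.
  - by case: d0; rewrite [LHS]dg kl; lia.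
have sgh : gsource h = gsource g by rewrite -isoh rgh.
have {dh} dgh : gdegree h = gdegree g by rewrite dh [RHS]dg.
apply: val_inj; move: rgh dgh sgh; rewrite /grange /gdegree /gsource.
by case: (val h) (val g) => [[? ?] ?] [[? ?] ?] /= -> -> ->.
Qed.

Theorem propositionA2 (E : digraph) (hE : row_finite_without_sources E) :
  closed ((isotropy E)° : set (graph_groupoid E)).
Proof.
move=> g clg.
have isog : isotropy E g.
  by apply: closed_isotropy; apply: closureS clg; exact: interior_subset.
have [d0|/eqP d0] := eqVneq (gdegree g) 0%R.
  exact: isotropy_interior_degree0.
have [N gN Ng] := isotropy_degree_neq0_isolated isog d0.
have [h [hint hN]] := clg N gN.
by rewrite -(Ng h (conj hN (interior_subset hint))).
Qed.
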